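(* Let $n \ge 1$ be an integer, let $e \in C(\mathbb{R})$ satisfy $e(t+2\pi)=e(t)$ for all $t$, and let $f,g \in C(\mathbb{R})$. Put $F(x)=\int_0^x f(z)\,dz$. Assume that the finite limits $F(\pm\infty)=\lim_{x\to\pm\infty}F(x)$ and $g(\pm\infty)=\lim_{x\to\pm\infty}g(x)$ exist, and that for all $x\in\mathbb{R}$ $$F(-\infty)<F(x)<F(\infty), \qquad g(-\infty)<g(x)<g(\infty).$$ Assume in addition that there is $\alpha\in\mathbb{R}$ with $f(x)\ge\alpha$ for all $x\in\mathbb{R}$. Let $A_n=\int_0^{2\pi}e(t)\cos nt\,dt$ and $B_n=\int_0^{2\pi}e(t)\sin nt\,dt$. If $$\sqrt{A_n^2+B_n^2}\ge 2n\left(F(\infty)-F(-\infty)\right)+2\left(g(\infty)-g(-\infty)\right),$$ then every solution $x(t)$, $t\in\mathbb{R}$, of $$x''+f(x)x'+g(x)+n^2x=e(t)$$ satisfies $$\lim_{t\to\infty}\left(x^2(t)+x'^2(t)\right)=\infty \quad\text{and}\quad \lim_{t\to-\infty}\left(x^2(t)+x'^2(t)\right)=\infty.$$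
   Context: Solutions are classical: $x$ is a $C^2$ real-valued function of $t\in\mathbb{R}$. *)

(* Defs.v *)
From Stdlib Require Import Reals.
From Coquelicot Require Import Coquelicot.
Open Scope R_scope.

Definition is_C0 (h : R -> R) : Prop := forall t, continuous h t.

(* [Derive] is total, so differentiability is required explicitly. *)
Definition is_C2 (x : R -> R) : Prop :=
  (forall t, ex_derive x t) /\
  (forall t, ex_derive (Derive x) t) /\
  is_C0 (Derive (Derive x)).

Definition is_solution (n : nat) (e f g x : R -> R) : Prop :=
  is_C2 x /\
  forall t,
    Derive (Derive x) t + f (x t) * Derive x t + g (x t) + INR n ^ 2 * x t
    = e t.

Definition prim0 (f : R -> R) (x : R) : R := RInt f 0 x.

Definition cos_coef (e : R -> R) (n : nat) : R :=
  RInt (fun t => e t * cos (INR n * t)) 0 (2 * PI).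

Definition sin_coef (e : R -> R) (n : nat) : R :=
  RInt (fun t => e t * sin (INR n * t)) 0 (2 * PI).

(* Main.v *)
Require Import Defs.
From Stdlib Require Import Reals ZArith Lra Lia Classical.
From Coquelicot Require Import Coquelicot.
Open Scope R_scope.

(* With y = x' + F(x) the equation becomes x' = y - F(x),
   y' = e - g(x) - n^2 x, and V = y cos(nt - p) + n x sin(nt - p) satisfies
   V' = (e - g(x)) cos(nt - p) - n F(x) sin(nt - p). For the phase p of (A_n, B_n),
   the e-term contributes sqrt(A_n^2 + B_n^2) over a period; since the cosine has
   mean zero and |cos| has integral 4, an oscillating integral of a function of
   range (a, b) is at most 2(b - a), and the g-term misses this bound by a uniform
   margin as long as x stays bounded. Hence V(t + 2 PI) - V(t) > 0 always, and it is
   bounded below whenever the energy at t is bounded (the energy is controlled on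
   the following two periods by Gronwall). The integral U of V over a period,
   whose derivative is this increment, is thus increasing, and if the energy did
   not tend to infinity then U would gain a fixed amount at infinitely many times
   at which it is bounded. *)

(** * Integration, monotonicity and periodicity of continuous functions *)

Lemma C0_ex_RInt (h : R -> R) (a b : R) : is_C0 h -> ex_RInt h a b.
Proof.
  intros hh. apply (ex_RInt_continuous (V := R_CompleteNormedModule)). intros z _. apply hh.
Qed.

Lemma C0_RInt_scal (k : R) (h : R -> R) (a b : R) : is_C0 h ->
  RInt (fun u => k * h u) a b = k * RInt h a b.
Proof. intros hh. apply (RInt_scal (V := R_CompleteNormedModule)). now apply C0_ex_RInt. Qed.

Lemma C0_RInt_plus (h k : R -> R) (a b : R) : is_C0 h -> is_C0 k ->
  RInt (fun u => h u + k u) a b = RInt h a b + RInt k a b.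
Proof.
  intros hh hk. apply (RInt_plus (V := R_CompleteNormedModule)); now apply C0_ex_RInt.
Qed.

Lemma C0_RInt_minus (h k : R -> R) (a b : R) : is_C0 h -> is_C0 k ->
  RInt (fun u => h u - k u) a b = RInt h a b - RInt k a b.
Proof.
  intros hh hk. apply (RInt_minus (V := R_CompleteNormedModule)); now apply C0_ex_RInt.
Qed.

Lemma is_derive_prim0 (f : R -> R) (z : R) : is_C0 f -> is_derive (prim0 f) z (f z).
Proof.
  intros hf. unfold prim0. apply is_derive_RInt with 0; [|apply hf].
  apply filter_forall. intros u. apply (RInt_correct (V := R_CompleteNormedModule)).
  now apply C0_ex_RInt.
Qed.

(** Serves twice: for periodic [h] the derivative vanishes, so the integral over a period does not
    depend on its start; for the rotating coordinate it identifies the derivative of its integral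
    over a period with its increment. *)
Lemma is_derive_window (h : R -> R) (T t : R) : is_C0 h ->
  is_derive (fun s => RInt h s (s + T)) t (h (t + T) - h t).
Proof.
  intros hh.
  apply is_derive_ext with (fun s => RInt h 0 (s + T) - RInt h 0 s).
  { intros s. rewrite <- (RInt_Chasles h 0 s (s + T)) by now apply C0_ex_RInt.
    unfold plus; simpl; ring. }
  apply (is_derive_minus (fun s => RInt h 0 (s + T)) (fun s => RInt h 0 s));
    [|now apply is_derive_prim0].
  evar_last.
  - apply (is_derive_comp (prim0 h) (fun s => s + T)); [now apply is_derive_prim0|].
    auto_derive; auto.
  - unfold scal; simpl; unfold mult; simpl; ring.
Qed.

Lemma derive_zero_const (h : R -> R) : (forall t, is_derive h t 0) ->
  forall a b, h a = h b.
Proof.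
  intros H a b.
  destruct (MVT_gen h b a (fun _ => 0)) as [c [_ Hc]].
  - intros; apply H.
  - intros t _. apply continuity_pt_filterlim, (@ex_derive_continuous R_AbsRing R_NormedModule).
    exists 0; apply H.
  - lra.
Qed.

Lemma derive_ge_growth (h h' : R -> R) (a b d : R) : a <= b ->
  (forall t, is_derive h t (h' t)) -> (forall t, a <= t <= b -> d <= h' t) ->
  h a + d * (b - a) <= h b.
Proof.
  intros hab H Hd.
  destruct (MVT_gen h a b h') as [c [Hc E]].
  - intros; apply H.
  - intros t _. apply continuity_pt_filterlim, (@ex_derive_continuous R_AbsRing R_NormedModule).
    exists (h' t); apply H.
  - rewrite Rmin_left, Rmax_right in Hc by lra.
    specialize (Hd c Hc). nra.
Qed.

Lemma RInt_periodic_window (h : R -> R) (T a b : R) : is_C0 h ->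
  (forall t, h (t + T) = h t) -> RInt h a (a + T) = RInt h b (b + T).
Proof.
  intros hh hT.
  apply (derive_zero_const (fun s => RInt h s (s + T))). intros t.
  evar_last; [now apply is_derive_window|]. rewrite hT; ring.
Qed.

Lemma RInt_periods (h : R -> R) (T a b : R) (k : nat) : is_C0 h ->
  (forall t, h (t + T) = h t) ->
  RInt h a (a + INR k * T) = INR k * RInt h b (b + T).
Proof.
  intros hh hT. induction k as [|k IH].
  - simpl. replace (a + 0 * T) with a by ring. rewrite RInt_point.
    unfold zero; simpl; ring.
  - rewrite <- (RInt_Chasles h a (a + INR k * T)) by now apply C0_ex_RInt.
    rewrite IH, S_INR.
    replace (a + (INR k + 1) * T) with (a + INR k * T + T) by ring.
    rewrite (RInt_periodic_window h T (a + INR k * T) b) by assumption.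
    unfold plus; simpl; ring.
Qed.

Lemma periodic_bounded (h : R -> R) (T : R) : is_C0 h -> 0 < T ->
  (forall t, h (t + T) = h t) -> exists B, forall t, Rabs (h t) <= B.
Proof.
  intros hh hT0 hT.
  destruct (continuity_ab_maj (fun t => Rabs (h t)) 0 T) as [m [Hm _]].
  - lra.
  - intros c _. apply continuity_pt_filterlim.
    apply (continuous_comp h Rabs); [apply hh|apply continuous_Rabs].
  - exists (Rabs (h m)). intros t.
    assert (Hn : forall k t, h (t + INR k * T) = h t).
    { induction k as [|k IH]; intros s.
      - simpl; f_equal; ring.
      - rewrite S_INR, <- (IH s), <- (hT (s + INR k * T)). f_equal; ring. }
    assert (Hz : forall z t, h (t + IZR z * T) = h t).
    { intros z s. destruct (Z_le_gt_dec 0 z) as [Hz|Hz].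
      - rewrite <- (Z2Nat.id z) by assumption. rewrite <- INR_IZR_INZ. apply Hn.
      - rewrite <- (Hn (Z.to_nat (- z)) (s + IZR z * T)). f_equal.
        rewrite INR_IZR_INZ, Z2Nat.id by lia. rewrite opp_IZR. ring. }
    (* Subtracting the integer part of [t / T] periods moves [t] into [[0, T]], where the maximum is
       attained at [m]. *)
    rewrite <- (Hz (- Int_part (t / T))%Z t).
    apply Hm. rewrite opp_IZR.
    destruct (base_Int_part (t / T)) as [H1 H2].
    assert (E : t = t / T * T) by (field; lra).
    set (q := t / T) in *. set (z := IZR (Int_part q)) in *. rewrite E.
    split; nra.
Qed.

(** * Oscillating integrals over a period, and the phase of the forcing *)

Lemma C0_wave (w p : R) : is_C0 (fun u => cos (w * u - p)).
Proof.
  intros u. apply (@ex_derive_continuous R_AbsRing R_NormedModule). auto_derive; auto.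
Qed.

Lemma C0_cos_freq (w : R) : is_C0 (fun u => cos (w * u)).
Proof.
  intros u. apply (@ex_derive_continuous R_AbsRing R_NormedModule). auto_derive; auto.
Qed.

Lemma C0_sin_freq (w : R) : is_C0 (fun u => sin (w * u)).
Proof.
  intros u. apply (@ex_derive_continuous R_AbsRing R_NormedModule). auto_derive; auto.
Qed.

Lemma C0_abs (h : R -> R) : is_C0 h -> is_C0 (fun u => Rabs (h u)).
Proof. intros hh u. apply (continuous_comp h Rabs); [apply hh|apply continuous_Rabs]. Qed.

Lemma C0_mult (h k : R -> R) : is_C0 h -> is_C0 k -> is_C0 (fun u => h u * k u).
Proof. intros hh hk u. apply (continuous_mult h k); [apply hh|apply hk]. Qed.

Lemma C0_cst (a : R) : is_C0 (fun _ => a).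
Proof. intros u. apply continuous_const. Qed.

Lemma C0_minus (h k : R -> R) : is_C0 h -> is_C0 k -> is_C0 (fun u => h u - k u).
Proof. intros hh hk u. apply (continuous_minus h k); [apply hh|apply hk]. Qed.

Lemma C0_derive (h h' : R -> R) : (forall t, is_derive h t (h' t)) -> is_C0 h.
Proof.
  intros H t. apply (@ex_derive_continuous R_AbsRing R_NormedModule). exists (h' t); apply H.
Qed.

(** The substitution [v = n u - p] turns the window into [2 n] periods of [|cos|], which has period
    [PI]. Each contributes 2, computed on [[-PI/2, PI/2]] where the cosine is nonnegative, and the
    substitution divides by [n]. *)
Lemma RInt_abs_wave (n : nat) (p t : R) : (1 <= n)%nat ->
  RInt (fun u => Rabs (cos (INR n * u - p))) t (t + 2 * PI) = 4.
Proof.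
  intros hn. assert (Hn : 1 <= INR n) by now apply (le_INR 1).
  assert (Hc : is_C0 (fun u => Rabs (cos u))) by (apply C0_abs; intros u; apply continuous_cos).
  assert (Hp : forall u, Rabs (cos (u + PI)) = Rabs (cos u)).
  { intros u. rewrite neg_cos. apply Rabs_Ropp. }
  assert (H2 : RInt (fun u => Rabs (cos u)) (- (PI / 2)) (- (PI / 2) + PI) = 2).
  { pose proof PI_RGT_0.
    rewrite (RInt_ext _ cos).
    - apply is_RInt_unique. evar_last.
      + apply (is_RInt_derive sin cos).
        * intros; apply is_derive_sin.
        * intros; apply continuous_cos.
      + replace (- (PI / 2) + PI) with (PI / 2) by field.
        rewrite sin_neg, sin_PI2. unfold minus, plus, opp; simpl; ring.
    - intros u. rewrite Rmin_left, Rmax_right by lra. intros Hu.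
      apply Rabs_pos_eq, cos_ge_0; lra. }
  assert (E : INR n * RInt (fun u => Rabs (cos (INR n * u - p))) t (t + 2 * PI)
            = INR (2 * n) * 2).
  { transitivity (INR (2 * n) * RInt (fun u => Rabs (cos u)) (- (PI / 2)) (- (PI / 2) + PI));
      [|now rewrite H2].
    rewrite <- (RInt_periods _ PI (INR n * t - p)) by assumption.
    replace (INR n * t - p) with (INR n * t + - p) by ring.
    replace (INR n * t + - p + INR (2 * n) * PI) with (INR n * (t + 2 * PI) + - p)
      by (rewrite mult_INR; simpl; ring).
    rewrite <- RInt_comp_lin by now apply C0_ex_RInt.
    symmetry. apply C0_RInt_scal, C0_abs, C0_wave. }
  rewrite mult_INR in E. simpl (INR 2) in E.
  apply Rmult_eq_reg_l with (INR n); lra.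
Qed.

Lemma RInt_wave (n : nat) (p t : R) : (1 <= n)%nat ->
  RInt (fun u => cos (INR n * u - p)) t (t + 2 * PI) = 0.
Proof.
  intros hn. assert (Hn : 1 <= INR n) by now apply (le_INR 1).
  apply is_RInt_unique. evar_last.
  - apply (is_RInt_derive (fun u => sin (INR n * u - p) / INR n)).
    + intros u _. auto_derive; auto. unfold Rminus. field; lra.
    + intros u _. apply C0_wave.
  - replace (INR n * (t + 2 * PI) - p) with (INR n * t - p + 2 * INR n * PI) by ring.
    rewrite sin_period. unfold minus, plus, opp; simpl; ring.
Qed.

(** The wave has mean zero, so [h] may be centred at any [m]; then [|cos|] has integral 4. Centring
    at the midpoint of the range of [h] makes [b] half its width. *)
Lemma RInt_mul_wave_le (n : nat) (h : R -> R) (p t m b : R) : (1 <= n)%nat ->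
  is_C0 h -> (forall u, t <= u <= t + 2 * PI -> Rabs (h u - m) <= b) ->
  RInt (fun u => h u * cos (INR n * u - p)) t (t + 2 * PI) <= 4 * b.
Proof.
  intros hn hh hb. pose proof PI_RGT_0.
  set (c := fun u => cos (INR n * u - p)).
  assert (Hc : is_C0 c) by apply C0_wave.
  replace (RInt (fun u => h u * cos (INR n * u - p)) t (t + 2 * PI))
    with (RInt (fun u => (h u - m) * c u) t (t + 2 * PI)).
  - rewrite <- (RInt_abs_wave n p t hn), (Rmult_comm _ b), <- C0_RInt_scal
      by now apply C0_abs, C0_wave.
    apply RInt_le.
    + lra.
    + now apply C0_ex_RInt, C0_mult; [apply C0_minus; [|apply C0_cst]|].
    + apply (C0_ex_RInt (fun u => b * Rabs (c u))), C0_mult; [apply C0_cst|now apply C0_abs].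
    + intros u Hu. eapply Rle_trans; [apply Rle_abs|]. rewrite Rabs_mult.
      apply Rmult_le_compat_r; [apply Rabs_pos|apply hb; lra].
  - rewrite (RInt_ext _ (fun u => h u * c u - m * c u)) by (intros; apply Rmult_minus_distr_r).
    rewrite C0_RInt_minus, C0_RInt_scal; try assumption.
    + unfold c at 2. rewrite RInt_wave, Rmult_0_r by assumption. apply Rminus_0_r.
    + now apply C0_mult.
    + now apply C0_mult; [apply C0_cst|].
Qed.

Lemma polar_angle (A B : R) : exists p, A * cos p + B * sin p = sqrt (A ^ 2 + B ^ 2).
Proof.
  set (r := sqrt (A ^ 2 + B ^ 2)).
  assert (Hr2 : r * r = A ^ 2 + B ^ 2) by (apply sqrt_sqrt; nra).
  assert (Hr : 0 <= r) by apply sqrt_pos.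
  destruct (Req_dec r 0) as [H0|H0].
  - exists 0. rewrite cos_0, sin_0. nra.
  - assert (HA : (A / r) ^ 2 + (B / r) ^ 2 = 1).
    { replace ((A / r) ^ 2 + (B / r) ^ 2) with ((A ^ 2 + B ^ 2) / (r * r)) by (field; lra).
      rewrite Hr2. field. nra. }
    set (a := A / r) in *. set (b := B / r) in *.
    assert (Ha : -1 <= a <= 1) by nra.
    assert (Hs : sin (acos a) = Rabs b).
    { rewrite sin_acos by assumption. replace (1 - a²) with (b²) by (unfold Rsqr; lra).
      apply sqrt_Rsqr_abs. }
    assert (EA : A = r * a) by (unfold a; field; lra).
    assert (EB : B = r * b) by (unfold b; field; lra).
    (* The arccosine fixes the angle only up to sign; the sign of [b] decides it. *)
    destruct (Rle_dec 0 b) as [Hb|Hb].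
    + exists (acos a). rewrite cos_acos, Hs, Rabs_pos_eq by assumption. nra.
    + exists (- acos a). rewrite cos_neg, sin_neg, cos_acos, Hs, Rabs_left by lra. nra.
Qed.

Lemma forcing_wave (n : nat) (e : R -> R) (p t : R) : is_C0 e ->
  (forall t, e (t + 2 * PI) = e t) ->
  RInt (fun u => e u * cos (INR n * u - p)) t (t + 2 * PI)
  = cos_coef e n * cos p + sin_coef e n * sin p.
Proof.
  intros he hper.
  rewrite (RInt_periodic_window _ _ t 0).
  - unfold cos_coef, sin_coef. rewrite Rplus_0_l.
    assert (Hc : is_C0 (fun u => e u * cos (INR n * u)))
      by (apply C0_mult; [assumption|apply C0_cos_freq]).
    assert (Hs : is_C0 (fun u => e u * sin (INR n * u)))
      by (apply C0_mult; [assumption|apply C0_sin_freq]).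
    rewrite (Rmult_comm _ (cos p)), (Rmult_comm _ (sin p)), <- 2 C0_RInt_scal, <- C0_RInt_plus
      by (try assumption; now apply C0_mult; [apply C0_cst|]).
    apply RInt_ext. intros u _. rewrite cos_minus.
    match goal with |- ?a = ?b => change (@eq R a b) end. ring.
  - apply C0_mult; [assumption|apply C0_wave].
  - intros s. rewrite hper. f_equal.
    replace (INR n * (s + 2 * PI) - p) with (INR n * s - p + 2 * INR n * PI) by ring.
    apply cos_period.
Qed.

(** * The planar system: energy growth and the increment of the rotating coordinate *)

(* The first-order system in the plane [y = x' + F(x)]. *)
Definition lienard (n : nat) (e F g x y : R -> R) : Prop :=
  forall t, is_derive x t (y t - F (x t)) /\
            is_derive y t (e t - g (x t) - INR n ^ 2 * x t).

Definition energy (n : nat) (x y : R -> R) (t : R) : R :=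
  INR n ^ 2 * x t ^ 2 + y t ^ 2.

(* Constant along [x'' + n^2 x = 0] (where [y = x']), so its growth is due to the
   forcing and the bounded nonlinearities alone. *)
Definition rotating_coord (n : nat) (p : R) (x y : R -> R) (t : R) : R :=
  y t * cos (INR n * t - p) + INR n * x t * sin (INR n * t - p).

(** In the derivative of the energy the terms in [x y] cancel. The remaining products involve only
    bounded factors, so [2ab <= a^2 + b^2] bounds the derivative by the energy plus a constant [C],
    and [(energy + C) exp(-u)] is nonincreasing. *)
Lemma energy_gronwall (n : nat) (e F g x y : R -> R) (E0 F0 : R) :
  lienard n e F g x y ->
  (forall t, Rabs (e t - g (x t)) <= E0) -> (forall z, Rabs (F z) <= F0) ->
  forall t s, t <= s ->
  energy n x y s <=
    (energy n x y t + (INR n ^ 2 * F0 ^ 2 + E0 ^ 2)) * exp (s - t).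
Proof.
  intros hs hE hF t s hts.
  set (C := INR n ^ 2 * F0 ^ 2 + E0 ^ 2).
  assert (HC : 0 <= C) by (unfold C; nra).
  pose (N' := fun u => -2 * INR n ^ 2 * (x u * F (x u)) + 2 * y u * (e u - g (x u))).
  assert (HN : forall u, is_derive (energy n x y) u (N' u)).
  { intros u. destruct (hs u) as [hx hy]. unfold energy, N'. evar_last.
    - apply (is_derive_plus (fun u => INR n ^ 2 * x u ^ 2) (fun u => y u ^ 2)).
      + apply is_derive_scal, is_derive_pow, hx.
      + apply is_derive_pow, hy.
    - unfold plus; simpl; ring. }
  assert (sq : forall a b, Rabs a <= b -> a ^ 2 <= b ^ 2).
  { intros a b H. rewrite <- (pow2_abs a).
    pose proof (Rabs_pos a). nra. }
  assert (HNle : forall u, N' u <= energy n x y u + C).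
  { intros u. unfold N', energy, C.
    pose proof (sq _ _ (hE u)) as H1. pose proof (sq _ _ (hF (x u))) as H2.
    assert (H3 : 2 * y u * (e u - g (x u)) <= y u ^ 2 + (e u - g (x u)) ^ 2)
      by (pose proof (pow2_ge_0 (y u - (e u - g (x u)))); nra).
    assert (H4 : -2 * (x u * F (x u)) <= x u ^ 2 + F0 ^ 2)
      by (pose proof (pow2_ge_0 (x u + F (x u))); nra).
    assert (H5 : 0 <= INR n ^ 2) by apply pow2_ge_0.
    apply (Rmult_le_compat_l _ _ _ H5) in H4. lra. }
  (* The sign is reversed so that a nonnegative derivative expresses the decay. *)
  pose (h := fun u => - ((energy n x y u + C) * exp (- u))).
  assert (Hh : forall u, is_derive h u ((energy n x y u + C - N' u) * exp (- u))).
  { intros u. unfold h. specialize (HN u).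
    auto_derive; [exists (N' u); exact HN|].
    rewrite (is_derive_unique (fun v : R => energy n x y v) _ _ HN). ring. }
  assert (H := derive_ge_growth h _ t s 0 hts Hh).
  assert (Hle : h t + 0 * (s - t) <= h s).
  { apply H. intros u _. apply Rmult_le_pos; [pose proof (HNle u); lra|].
    left; apply exp_pos. }
  unfold h in Hle.
  assert (K : (energy n x y s + C) * exp (- s) * exp s
              <= (energy n x y t + C) * exp (- t) * exp s)
    by (apply Rmult_le_compat_r; [left; apply exp_pos|lra]).
  rewrite !Rmult_assoc, <- !exp_plus in K.
  replace (- s + s) with 0 in K by ring. rewrite exp_0 in K.
  replace (- t + s) with (s - t) in K by ring. lra.
Qed.

Lemma is_derive_rotating_coord (n : nat) (e F g x y : R -> R) (p t : R) :
  lienard n e F g x y ->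
  is_derive (rotating_coord n p x y) t
    ((e t - g (x t)) * cos (INR n * t - p) - INR n * F (x t) * sin (INR n * t - p)).
Proof.
  intros hs. destruct (hs t) as [hx hy]. unfold rotating_coord.
  auto_derive.
  - repeat split; eexists; eassumption.
  - rewrite (is_derive_unique (fun u : R => x u) _ _ hx),
      (is_derive_unique (fun u : R => y u) _ _ hy). unfold Rminus; ring.
Qed.

Lemma Rabs_rotating_coord_le (n : nat) (p t : R) (x y : R -> R) :
  Rabs (rotating_coord n p x y t) <= 1 + energy n x y t.
Proof.
  unfold rotating_coord, energy.
  set (c := INR n * t - p). pose proof (sin2_cos2 c) as H. unfold Rsqr in H.
  pose proof (pow2_ge_0 (y t - cos c)). pose proof (pow2_ge_0 (y t + cos c)).
  pose proof (pow2_ge_0 (INR n * x t - sin c)). pose proof (pow2_ge_0 (INR n * x t + sin c)).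
  apply Rabs_le. split; nra.
Qed.

(** By compactness the largest deviation from the midpoint is attained, hence is strictly below half
    the range. Applied to [g], this margin yields a strict gain even when the hypothesis on the
    Fourier coefficients is an equality. *)
Lemma strict_range_margin (h : R -> R) (a b X : R) : is_C0 h -> 0 <= X ->
  (forall z, a < h z < b) ->
  exists eta, 0 < eta /\
    forall z, Rabs z <= X -> Rabs (h z - (a + b) / 2) <= (b - a) / 2 - eta.
Proof.
  intros hh hX hab.
  destruct (continuity_ab_maj (fun z => Rabs (h z - (a + b) / 2)) (- X) X) as [m [Hm _]].
  - lra.
  - intros z _. apply continuity_pt_filterlim.
    apply (C0_abs (fun z => h z - (a + b) / 2)), C0_minus; [assumption|apply C0_cst].
  - exists ((b - a) / 2 - Rabs (h m - (a + b) / 2)). split.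
    + specialize (hab m). assert (Rabs (h m - (a + b) / 2) < (b - a) / 2)
        by (apply Rabs_def1; lra). lra.
    + intros z Hz. apply Rabs_le_between in Hz. specialize (Hm z Hz). simpl in Hm. lra.
Qed.

(** The forcing contributes its projection on the phase [p]; the terms in [g] and [F] cost at most
    [4 b] and [n] times [4 (Fp - Fm) / 2]. The bound on [g] is asked only along the window, so that
    the margin on bounded sets can enter through [b]. *)
Lemma rotating_coord_increment (n : nat) (e F g x y : R -> R) (p t Fm Fp m b : R) :
  (1 <= n)%nat -> is_C0 e -> (forall t, e (t + 2 * PI) = e t) ->
  is_C0 F -> is_C0 g -> lienard n e F g x y -> (forall z, Fm < F z < Fp) ->
  (forall u, t <= u <= t + 2 * PI -> Rabs (g (x u) - m) <= b) ->
  cos_coef e n * cos p + sin_coef e n * sin p - 4 * b - 2 * INR n * (Fp - Fm)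
    <= rotating_coord n p x y (t + 2 * PI) - rotating_coord n p x y t.
Proof.
  intros hn he hper hF hg hs hFb hgb.
  assert (hx : is_C0 x) by (apply C0_derive with (fun t => y t - F (x t)); intros u; apply hs).
  assert (hFx : is_C0 (fun u => F (x u)))
    by (intros u; apply (continuous_comp x F); [apply hx|apply hF]).
  assert (hgx : is_C0 (fun u => g (x u)))
    by (intros u; apply (continuous_comp x g); [apply hx|apply hg]).
  set (c := fun q u => cos (INR n * u - q)).
  assert (hc : forall q, is_C0 (c q)) by (intros q; apply C0_wave).
  (* A quarter-turn of phase turns the sine multiplying [F] into a cosine, so one estimate serves
     both terms. *)
  set (q := p + PI / 2).
  assert (Hec : is_C0 (fun u => e u * c p u)) by now apply C0_mult.
  assert (Hgc : is_C0 (fun u => g (x u) * c p u)) by now apply C0_mult.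
  assert (HFc : is_C0 (fun u => F (x u) * c q u)) by now apply C0_mult.
  assert (HnFc : is_C0 (fun u => INR n * (F (x u) * c q u)))
    by (apply C0_mult; [apply C0_cst|assumption]).
  assert (H : is_RInt (fun u => e u * c p u - g (x u) * c p u - INR n * (F (x u) * c q u))
                t (t + 2 * PI)
                (rotating_coord n p x y (t + 2 * PI) - rotating_coord n p x y t)).
  { apply (is_RInt_derive (rotating_coord n p x y)).
    - intros u _. evar_last; [now apply (is_derive_rotating_coord n e F g)|].
      unfold c, q. replace (INR n * u - (p + PI / 2)) with (- (PI / 2 - (INR n * u - p))) by ring.
      rewrite cos_neg, cos_shift. ring.
    - intros u _. apply (C0_minus (fun u => e u * c p u - g (x u) * c p u)); [|assumption].
      now apply C0_minus. }
  rewrite <- (is_RInt_unique (V := R_CompleteNormedModule) _ _ _ _ H).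
  rewrite (C0_RInt_minus (fun u => e u * c p u - g (x u) * c p u)), C0_RInt_minus, C0_RInt_scal;
    try assumption; [|now apply C0_minus].
  unfold c. rewrite forcing_wave by assumption.
  assert (Bg := RInt_mul_wave_le n (fun u => g (x u)) p t m b hn hgx hgb).
  assert (BF : RInt (fun u => F (x u) * cos (INR n * u - q)) t (t + 2 * PI)
               <= 4 * ((Fp - Fm) / 2)).
  { apply RInt_mul_wave_le with (m := (Fm + Fp) / 2); try assumption.
    intros u _. specialize (hFb (x u)). apply Rabs_le. lra. }
  apply (Rmult_le_compat_l (INR n)) in BF; [|apply pos_INR].
  unfold c in *. lra.
Qed.

(** * Divergence from recurrent gains *)

Lemma is_lim_p_infty_of_gt (r : R -> R) (b : Rbar) :
  (forall M, Rbar_locally' b (fun t => M < r t)) -> is_lim r b p_infty.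
Proof.
  intros H P [M HM]. unfold filtermap.
  apply (filter_imp (fun t => M < r t)); [intros t; apply HM|apply H].
Qed.

(* [U] grows by a fixed amount over each window of length [T] starting with
   [r <= M], yet is bounded at those starting times: hence only finitely many
   such windows can be disjoint. *)
Lemma infty_of_recurrent_gain (r U : R -> R) (T : R) :
  (forall s t, s <= t -> U s <= U t) ->
  (forall M, exists d K, 0 < d /\
     forall t, r t <= M -> Rabs (U t) <= K /\ U t + d <= U (t + T)) ->
  is_lim r p_infty p_infty /\ is_lim r m_infty p_infty.
Proof.
  intros hU hgain.
  assert (big : forall d K, 0 < d -> exists k, K < INR k * d).
  { intros d K hd. destruct (archimed_cor1 (d / (Rabs K + 1))) as [k [Hk Hk0]].
    - apply Rdiv_lt_0_compat; [assumption|]. pose proof (Rabs_pos K); lra.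
    - exists k. assert (Hk1 : 0 < INR k) by now apply lt_0_INR.
      pose proof (Rle_abs K). pose proof (Rabs_pos K).
      apply (Rmult_lt_compat_r (INR k * (Rabs K + 1))) in Hk; [|nra].
      replace (/ INR k * (INR k * (Rabs K + 1))) with (Rabs K + 1) in Hk by (field; lra).
      replace (d / (Rabs K + 1) * (INR k * (Rabs K + 1))) with (INR k * d) in Hk by (field; lra).
      lra. }
  (* At times with [r <= M] the values of [U] lie in an interval of length [2 K], which [k] gains of
     [d] overrun. *)
  split; apply is_lim_p_infty_of_gt; intros M; destruct (hgain M) as [d [K [hd H]]];
    destruct (big d (2 * K) hd) as [k Hk]; apply NNPP; intros Hnot.
  - assert (Hrec : forall S, exists t, S < t /\ r t <= M).
    { intros S. apply NNPP. intros HS. apply Hnot. exists S. intros t Ht.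
      apply Rnot_le_lt. intros Hr. apply HS. now exists t. }
    assert (Hk' : forall j, exists t, r t <= M /\ - K + INR j * d <= U t).
    { induction j as [|j [t [Ht HUt]]].
      - destruct (Hrec 0) as [t [_ Ht]]. exists t. split; [assumption|].
        destruct (H t Ht) as [Hb _]. apply Rabs_le_between in Hb. simpl. lra.
      - destruct (Hrec (t + T)) as [t' [Htt' Ht']]. exists t'. split; [assumption|].
        destruct (H t Ht) as [_ Hg]. pose proof (hU (t + T) t' (Rlt_le _ _ Htt')).
        rewrite S_INR. lra. }
    destruct (Hk' k) as [t [Ht HUt]]. destruct (H t Ht) as [Hb _].
    apply Rabs_le_between in Hb. lra.
  - assert (Hrec : forall S, exists t, t < S /\ r t <= M).
    { intros S. apply NNPP. intros HS. apply Hnot. exists S. intros t Ht.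
      apply Rnot_le_lt. intros Hr. apply HS. now exists t. }
    assert (Hk' : forall j, exists t, r t <= M /\ U t <= K - INR j * d).
    { induction j as [|j [t [Ht HUt]]].
      - destruct (Hrec 0) as [t [_ Ht]]. exists t. split; [assumption|].
        destruct (H t Ht) as [Hb _]. apply Rabs_le_between in Hb. simpl. lra.
      - destruct (Hrec (t - T)) as [t' [Htt' Ht']]. exists t'. split; [assumption|].
        destruct (H t' Ht') as [_ Hg]. assert (U (t' + T) <= U t) by (apply hU; lra).
        rewrite S_INR. lra. }
    destruct (Hk' k) as [t [Ht HUt]]. destruct (H t Ht) as [Hb _].
    apply Rabs_le_between in Hb. lra.
Qed.

(** * Divergence of the energy, and return to the scalar equation *)

Lemma lienard_energy_infty (n : nat) (e F g x y : R -> R) (Fm Fp gm gp : R) :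
  (1 <= n)%nat -> is_C0 e -> (forall t, e (t + 2 * PI) = e t) ->
  is_C0 F -> is_C0 g ->
  (forall z, Fm < F z < Fp) -> (forall z, gm < g z < gp) ->
  sqrt (cos_coef e n ^ 2 + sin_coef e n ^ 2) >= 2 * INR n * (Fp - Fm) + 2 * (gp - gm) ->
  lienard n e F g x y ->
  is_lim (energy n x y) p_infty p_infty /\ is_lim (energy n x y) m_infty p_infty.
Proof.
  intros hn he hper hF hg hFb hgb hA hs. pose proof PI_RGT_0 as hPI.
  assert (Hn : 1 <= INR n) by now apply (le_INR 1).
  destruct (polar_angle (cos_coef e n) (sin_coef e n)) as [p hp].
  destruct (periodic_bounded e (2 * PI) he ltac:(lra) hper) as [E He].
  set (E0 := E + (Rabs gm + Rabs gp)). set (F0 := Rabs Fm + Rabs Fp).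
  assert (strict_abs : forall a b z, a < z < b -> Rabs z <= Rabs a + Rabs b).
  { intros a b z Hz. pose proof (Rle_abs b). pose proof (Rle_abs (- a)) as Ha.
    rewrite Rabs_Ropp in Ha. pose proof (Rabs_pos a). pose proof (Rabs_pos b).
    apply Rabs_le. lra. }
  assert (hE0 : forall t, Rabs (e t - g (x t)) <= E0).
  { intros t. unfold Rminus, E0. eapply Rle_trans; [apply Rabs_triang|]. rewrite Rabs_Ropp.
    apply Rplus_le_compat; [apply He|now apply strict_abs]. }
  assert (hF0 : forall z, Rabs (F z) <= F0) by (intros z; now apply strict_abs).
  set (V := rotating_coord n p x y).
  assert (hV : is_C0 V)
    by (eapply C0_derive; intros t; now apply (is_derive_rotating_coord n e F g)).
  assert (Hgain : forall M, exists d N, 0 < d /\ forall t, energy n x y t <= M ->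
            (forall u, t <= u <= t + 2 * PI -> Rabs (V u) <= N) /\
            (forall u, t <= u <= t + 2 * PI -> d <= V (u + 2 * PI) - V u)).
  { intros M. set (C := INR n ^ 2 * F0 ^ 2 + E0 ^ 2).
    set (X := (Rabs M + C) * exp (4 * PI)).
    assert (HC : 0 <= C) by (unfold C; nra).
    assert (HX : 0 <= X).
    { apply Rmult_le_pos; [pose proof (Rabs_pos M); lra|left; apply exp_pos]. }
    (* Two periods are needed: increments start at any [u] in the first one and run over a further
       period. *)
    assert (HB : forall t, energy n x y t <= M ->
              forall u, t <= u <= t + 4 * PI -> energy n x y u <= X).
    { intros t Ht u Hu.
      eapply Rle_trans; [now apply (energy_gronwall n e F g x y E0 F0 hs hE0 hF0 t u)|].
      fold C. pose proof (Rle_abs M).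
      assert (0 <= energy n x y t) by (unfold energy; nra).
      apply Rmult_le_compat; [lra|left; apply exp_pos|lra|].
      destruct (Rle_lt_or_eq_dec (u - t) (4 * PI)) as [Hlt|Heq]; [lra| |].
      - left; now apply exp_increasing.
      - rewrite Heq; lra. }
    (* Energy at most [X] forces [|x| <= 1 + x^2 <= 1 + X], since [n >= 1]. *)
    destruct (strict_range_margin g gm gp (1 + X) hg ltac:(lra) hgb) as [eta [Heta Hmar]].
    (* Lowering the bound on the centred [g] by [eta] lowers its cost by [4 eta], which is the
       gain. *)
    exists (4 * eta), (1 + X). split; [lra|]. intros t Ht. split.
    - intros u Hu. eapply Rle_trans; [apply Rabs_rotating_coord_le|].
      pose proof (HB t Ht u ltac:(lra)). lra.
    - intros u Hu.
      assert (K := rotating_coord_increment n e F g x y p u Fm Fp ((gm + gp) / 2)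
                     ((gp - gm) / 2 - eta) hn he hper hF hg hs hFb).
      rewrite hp in K. fold V in K. eapply Rle_trans; [|apply K; intros v Hv].
      + lra.
      + apply Hmar. pose proof (HB t Ht v ltac:(lra)) as Hx. unfold energy in Hx.
        pose proof (pow2_ge_0 (y v)).
        assert (1 * x v ^ 2 <= INR n ^ 2 * x v ^ 2)
          by (apply Rmult_le_compat_r; [apply pow2_ge_0|nra]).
        pose proof (pow2_ge_0 (x v - 1)). pose proof (pow2_ge_0 (x v + 1)).
        apply Rabs_le. split; nra. }
  set (U := fun t => RInt V t (t + 2 * PI)).
  assert (hU : forall t, is_derive U t (V (t + 2 * PI) - V t))
    by (intros t; now apply is_derive_window).
  apply (infty_of_recurrent_gain (energy n x y) U (2 * PI)).
  - intros s t Hst.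
    pose proof (derive_ge_growth U _ s t 0 Hst hU) as G.
    rewrite Rmult_0_l, Rplus_0_r in G. apply G. intros u _.
    (* Taking the energy at [u] itself as the bound makes the increment positive at every time. *)
    destruct (Hgain (energy n x y u)) as [d [N [Hd HdN]]].
    destruct (HdN u (Rle_refl _)) as [_ Hinc]. specialize (Hinc u ltac:(lra)). lra.
  - intros M. destruct (Hgain M) as [d [N [Hd HdN]]].
    exists (d * (2 * PI)), (2 * PI * N). split; [nra|].
    intros t Ht. destruct (HdN t Ht) as [HV Hinc]. split.
    + unfold U. replace (2 * PI * N) with ((t + 2 * PI - t) * N) by ring.
      apply abs_RInt_le_const; [lra|now apply C0_ex_RInt|assumption].
    + pose proof (derive_ge_growth U _ t (t + 2 * PI) d ltac:(lra) hU Hinc) as G.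
      replace (t + 2 * PI - t) with (2 * PI) in G by ring. exact G.
Qed.

(** The damping [f(x) x'] is the derivative of [F(x)]; absorbing it into [y] leaves only the bounded
    [F] in the system. *)
Lemma solution_lienard (n : nat) (e f g x : R -> R) : is_C0 f ->
  is_solution n e f g x ->
  lienard n e (prim0 f) g x (fun t => Derive x t + prim0 f (x t)).
Proof.
  intros hf [[hx [hx' _]] heq] t. split.
  - evar_last; [apply Derive_correct, hx|ring].
  - evar_last.
    + apply (is_derive_plus (Derive x) (fun t => prim0 f (x t))).
      * apply Derive_correct, hx'.
      * apply (is_derive_comp (prim0 f) x); [now apply is_derive_prim0|apply Derive_correct, hx].
    + specialize (heq t). unfold plus, scal; simpl; unfold mult; simpl. simpl in heq. lra.
Qed.

Theorem proposition3 (n : nat) (hn : (1 <= n)%nat) (e f g : R -> R)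
  (he : is_C0 e) (hper : forall t : R, e (t + 2 * PI) = e t)
  (hf : is_C0 f) (hg : is_C0 g)
  (Fm Fp gm gp : R)
  (hFm : is_lim (prim0 f) m_infty (Finite Fm))
  (hFp : is_lim (prim0 f) p_infty (Finite Fp))
  (hgm : is_lim g m_infty (Finite gm))
  (hgp : is_lim g p_infty (Finite gp))
  (hF : forall x : R, Fm < prim0 f x < Fp)
  (hgb : forall x : R, gm < g x < gp)
  (hlow : exists alpha : R, forall x : R, f x >= alpha)
  (hAB : sqrt (cos_coef e n ^ 2 + sin_coef e n ^ 2)
         >= 2 * INR n * (Fp - Fm) + 2 * (gp - gm)) :
  forall x : R -> R, is_solution n e f g x ->
    is_lim (fun t => x t ^ 2 + Derive x t ^ 2) p_infty p_infty /\
    is_lim (fun t => x t ^ 2 + Derive x t ^ 2) m_infty p_infty.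
Proof.
  intros x hx.
  assert (Hn : 1 <= INR n) by now apply (le_INR 1).
  assert (hFc : is_C0 (prim0 f)) by (apply C0_derive with f; intros z; now apply is_derive_prim0).
  set (y := fun t => Derive x t + prim0 f (x t)).
  set (F0 := Rmax (Fp ^ 2) (Fm ^ 2)).
  (* From [(a + b)^2 <= 2 a^2 + 2 b^2] and [n >= 1]; thus divergence of the energy carries over to
     [x^2 + x'^2]. *)
  assert (Hle : forall t, energy n x y t <= 2 * INR n ^ 2 * (x t ^ 2 + Derive x t ^ 2) + 2 * F0).
  { intros t. unfold energy, y.
    assert (HF2 : prim0 f (x t) ^ 2 <= F0).
    { specialize (hF (x t)). unfold F0.
      pose proof (Rmax_l (Fp ^ 2) (Fm ^ 2)). pose proof (Rmax_r (Fp ^ 2) (Fm ^ 2)).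
      destruct (Rle_dec 0 (prim0 f (x t))); nra. }
    pose proof (pow2_ge_0 (Derive x t - prim0 f (x t))).
    assert (0 <= (INR n ^ 2 - 1) * Derive x t ^ 2)
      by (apply Rmult_le_pos; [nra|apply pow2_ge_0]).
    assert (0 <= INR n ^ 2 * x t ^ 2) by (apply Rmult_le_pos; apply pow2_ge_0).
    nra. }
  destruct (lienard_energy_infty n e (prim0 f) g x y Fm Fp gm gp) as [Hp Hm]; try assumption.
  { now apply solution_lienard. }
  assert (tr : forall b, is_lim (energy n x y) b p_infty ->
                 is_lim (fun t => x t ^ 2 + Derive x t ^ 2) b p_infty).
  { intros b Hb. apply is_lim_p_infty_of_gt. intros M.
    assert (Hev : Rbar_locally' b (fun t => 2 * INR n ^ 2 * M + 2 * F0 < energy n x y t)).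
    { apply (Hb (fun z => 2 * INR n ^ 2 * M + 2 * F0 < z)).
      exists (2 * INR n ^ 2 * M + 2 * F0). now intros z. }
    eapply filter_imp; [|exact Hev]. intros t Ht. specialize (Hle t).
    apply Rmult_lt_reg_l with (2 * INR n ^ 2); [nra|lra]. }
  split; apply tr; assumption.
Qed.
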